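(* Let $m,n,p,r$ be positive integers, let $\mathcal{A}:\mathbb{C}^{m\times n}\to\mathbb{C}^p$ be a linear operator with $\delta_{4r}(\mathcal{A})\le 0.04$, let $X_0\in\mathbb{C}^{m\times n}$ and $\nu\in\mathbb{C}^p$ be arbitrary, and let $b=\mathcal{A}X_0+\nu$. Let $(\widehat{X}_k)_{k\ge 0}$ be any sequence of estimates produced by ADMiRA with input $(\mathcal{A},b,r)$. Then for every $k\ge 0$, $$\|X_0-\widehat{X}_{k+1}\|_F\le 0.5\,\|X_0-\widehat{X}_k\|_F+8\epsilon,$$ and consequently $$\|X_0-\widehat{X}_k\|_F\le 2^{-k}\|X_0\|_F+16\epsilon\quad\text{for all }k\ge 0,$$ where $\epsilon=\|X_0-X_{0,r}\|_F+\frac{1}{\sqrt r}\|X_0-X_{0,r}\|_*+\|\nu\|_2$ and $X_{0,r}$ is a best rank-$r$ approximation of $X_0$ in Frobenius norm.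
   Context: $\mathbb{C}^p$ has inner product $\langle x,y\rangle=y^Hx$ and norm $\|\cdot\|_2$; $\mathbb{C}^{m\times n}$ has inner product $\langle X,Y\rangle=\mathrm{tr}(Y^HX)$ and Frobenius norm $\|\cdot\|_F$; $\|\cdot\|_*$ is the nuclear norm (sum of singular values); $\mathcal{A}^*$ is the adjoint of $\mathcal{A}$ with respect to these inner products. For $s\ge1$, the rank-restricted isometry constant $\delta_s(\mathcal{A})$ is the smallest $\delta\ge0$ such that $(1-\delta)\|X\|_F^2\le\|\mathcal{A}X\|_2^2\le(1+\delta)\|X\|_F^2$ for all $X$ with $\mathrm{rank}(X)\le s$. The set of atoms $\mathbb{O}$ is a set of rank-one matrices in $\mathbb{C}^{m\times n}$ of unit Frobenius norm such that every nonzero rank-one matrix is a scalar multiple of exactly one element of $\mathbb{O}$. For $\Psi\subset\mathbb{O}$, $\mathcal{P}_\Psi$ denotes the orthogonal projection of $\mathbb{C}^{m\times n}$ onto $\mathrm{span}(\Psi)$. ADMiRA with input $(\mathcal{A},b,r)$: set $\widehat{X}_0=0$, $\widehat{\Psi}_0=\emptyset$; for $k=0,1,2,\dots$: (1) choose $\Psi'_{k+1}$ maximizing $\|\mathcal{P}_\Psi\mathcal{A}^*(b-\mathcal{A}\widehat{X}_k)\|_F$ over $\Psi\subset\mathbb{O}$ with $|\Psi|\le 2r$; (2) $\widetilde{\Psi}_{k+1}=\Psi'_{k+1}\cup\widehat{\Psi}_k$; (3) $\widetilde{X}_{k+1}$ minimizes $\|b-\mathcal{A}X\|_2$ over $X\in\mathrm{span}(\widetilde{\Psi}_{k+1})$;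 (4) choose $\widehat{\Psi}_{k+1}$ maximizing $\|\mathcal{P}_\Psi\widetilde{X}_{k+1}\|_F$ over $\Psi\subset\mathbb{O}$ with $|\Psi|\le r$; (5) $\widehat{X}_{k+1}=\mathcal{P}_{\widehat{\Psi}_{k+1}}\widetilde{X}_{k+1}$. $\widehat{X}_k$ is called the estimate in the $k$-th iteration. *)

(* Defs.v *)
From HB Require Import structures.
From Stdlib Require Import ClassicalEpsilon.
From mathcomp Require Import all_boot all_order all_algebra.
From mathcomp Require Import classical_sets reals.
From mathcomp Require Import complex.

Set Implicit Arguments.
Unset Strict Implicit.
Unset Printing Implicit Defensive.

Import Order.TTheory GRing.Theory Num.Theory.
Local Open Scope ring_scope.

Definition mxH (R : rcfType) (k l : nat) (Y : 'M[R[i]]_(k, l)) : 'M[R[i]]_(l, k) :=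
  (map_mx conjc Y)^T.

Definition vdot (R : rcfType) (p : nat) (x y : 'cV[R[i]]_p) : R[i] :=
  (mxH y *m x) 0 0.

Definition mdot (R : rcfType) (m n : nat) (X Y : 'M[R[i]]_(m, n)) : R[i] :=
  \tr (mxH Y *m X).

Definition norm2 (R : rcfType) (p : nat) (x : 'cV[R[i]]_p) : R :=
  Num.sqrt (complex.Re (vdot x x)).

Definition frob (R : rcfType) (m n : nat) (X : 'M[R[i]]_(m, n)) : R :=
  Num.sqrt (complex.Re (mdot X X)).

Definition eigvals (R : rcfType) (n : nat) (M : 'M[R[i]]_n) : seq R[i] :=
  epsilon (inhabits [::])
    (fun s : seq R[i] => char_poly M = \prod_(l <- s) ('X - l%:P)).

(* Nuclear norm: sum of the singular values of X, i.e. of the square roots of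
   the eigenvalues of X^H X (extra zero eigenvalues contribute nothing). *)
Definition nuc (R : rcfType) (m n : nat) (X : 'M[R[i]]_(m, n)) : R :=
  \sum_(l <- eigvals (mxH X *m X)) Num.sqrt (complex.Re l).

Definition adj (R : rcfType) (m n p : nat)
    (A : 'M[R[i]]_(m, n) -> 'cV[R[i]]_p) (y : 'cV[R[i]]_p) : 'M[R[i]]_(m, n) :=
  epsilon (inhabits 0)
    (fun Z : 'M[R[i]]_(m, n) => forall X, vdot (A X) y = mdot X Z).

Definition ric (R : realType) (m n p : nat)
    (A : 'M[R[i]]_(m, n) -> 'cV[R[i]]_p) (s : nat) : R :=
  inf [set d : R | 0 <= d /\
        forall X : 'M[R[i]]_(m, n), (\rank X <= s)%N ->
          (1 - d) * frob X ^+ 2 <= norm2 (A X) ^+ 2 <= (1 + d) * frob X ^+ 2].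

Definition atoms (R : rcfType) (m n : nat) (O : set 'M[R[i]]_(m, n)) : Prop :=
  (forall a, O a -> \rank a = 1%N /\ frob a = 1) /\
  (forall M : 'M[R[i]]_(m, n), \rank M = 1%N ->
     exists! a, O a /\ exists c : R[i], M = c *: a).

(* Finite families of atoms are given as sequences; Psi is a subset of O
   with |Psi| <= k. *)
Definition admissible (R : rcfType) (m n : nat) (O : set 'M[R[i]]_(m, n))
    (k : nat) (Psi : seq 'M[R[i]]_(m, n)) : Prop :=
  (forall a, a \in Psi -> O a) /\ (size Psi <= k)%N.

Definition inspan (R : rcfType) (m n : nat) (Psi : seq 'M[R[i]]_(m, n))
    (Y : 'M[R[i]]_(m, n)) : Prop :=
  exists c : 'I_(size Psi) -> R[i], Y = \sum_(j < size Psi) c j *: Psi`_j.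

Definition proj (R : rcfType) (m n : nat) (Psi : seq 'M[R[i]]_(m, n))
    (X : 'M[R[i]]_(m, n)) : 'M[R[i]]_(m, n) :=
  epsilon (inhabits 0)
    (fun Y => inspan Psi Y /\ forall Z, inspan Psi Z -> mdot (X - Y) Z = 0).

Definition best_rank_approx (R : rcfType) (m n : nat) (r : nat)
    (X Xr : 'M[R[i]]_(m, n)) : Prop :=
  (\rank Xr <= r)%N /\
  forall Y : 'M[R[i]]_(m, n), (\rank Y <= r)%N -> frob (X - Xr) <= frob (X - Y).

(* Xh is a sequence of estimates produced by ADMiRA with input (A, b, r),
   for the set of atoms O (all choices in steps (1),(3),(4) allowed). *)
Definition admira (R : rcfType) (m n p : nat)
    (A : 'M[R[i]]_(m, n) -> 'cV[R[i]]_p) (b : 'cV[R[i]]_p) (r : nat)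
    (O : set 'M[R[i]]_(m, n)) (Xh : nat -> 'M[R[i]]_(m, n)) : Prop :=
  exists (Psih Psip Psit : nat -> seq 'M[R[i]]_(m, n))
         (Xt : nat -> 'M[R[i]]_(m, n)),
    Xh 0%N = 0 /\ Psih 0%N = [::] /\
    forall k : nat,
      [/\
          admissible O (2 * r) (Psip k.+1) /\
          (forall Psi, admissible O (2 * r) Psi ->
             frob (proj Psi (adj A (b - A (Xh k))))
               <= frob (proj (Psip k.+1) (adj A (b - A (Xh k))))),
          Psit k.+1 = Psip k.+1 ++ Psih k,
          inspan (Psit k.+1) (Xt k.+1) /\
          (forall X, inspan (Psit k.+1) X ->
             norm2 (b - A (Xt k.+1)) <= norm2 (b - A X)),
          admissible O r (Psih k.+1) /\
          (forall Psi, admissible O r Psi ->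
             frob (proj Psi (Xt k.+1)) <= frob (proj (Psih k.+1) (Xt k.+1)))
        &
          Xh k.+1 = proj (Psih k.+1) (Xt k.+1)].

(* Main.v *)
(* Write E for the current error with respect to the best rank-r approximation X
   of X0, so that b = A X + nu' with nu' = A (X0 - X) + nu, and d = 0.04.
   Identification: the proxy Y = A^*(A E + nu') is close to E as far as matrices of
   rank at most 4r can see, so its best rank-2r approximation Y' satisfies
   |E - Y'| <= 2 (d |E| + sqrt(1 + d) |nu'|).
   Least squares: the normal equations and the restricted isometry property compare
   the minimiser with the orthogonal projection of X, giving
   (1 - d) |X - Xt| <= |E - Y'| + sqrt(1 + d) |nu'|; truncation to rank r at most
   doubles this error.  Finally |A D| <= sqrt(1 + d) (|D|_F + |D|_* / sqrt r) for all D,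
   by splitting a decreasing singular value decomposition into blocks of length r. *)
Require Import Defs.
From HB Require Import structures.
From mathcomp Require Import all_boot all_order all_algebra.
From mathcomp Require Import classical_sets reals.
From mathcomp Require Import complex.
From mathcomp Require Import ring lra.
From Stdlib Require Import ClassicalEpsilon.
Set Implicit Arguments.
Unset Strict Implicit.
Unset Printing Implicit Defensive.
Import Order.TTheory GRing.Theory Num.Theory.
Local Open Scope ring_scope.

(** * Hermitian and real inner products on matrices, and the Frobenius norm *)

Lemma mdotE (R : rcfType) (m n : nat) (X Y : 'M[R[i]]_(m, n)) :
  mdot X Y = \sum_i \sum_j X i j * conjc (Y i j).
Proof.
rewrite /mdot /mxH /mxtrace exchange_big /=; apply: eq_bigr => j _.
by rewrite !mxE; apply: eq_bigr => i _; rewrite !mxE mulrC.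
Qed.

Lemma vdot_mdot (R : rcfType) (p : nat) (x y : 'cV[R[i]]_p) : vdot x y = mdot x y.
Proof. by rewrite /vdot /mdot /mxtrace big_ord1. Qed.

Lemma norm2_frob (R : rcfType) (p : nat) (x : 'cV[R[i]]_p) : norm2 x = frob x.
Proof. by rewrite /norm2 /frob vdot_mdot. Qed.

Lemma mdotDl (R : rcfType) (m n : nat) (X Y Z : 'M[R[i]]_(m, n)) :
  mdot (X + Y) Z = mdot X Z + mdot Y Z.
Proof. by rewrite /mdot mulmxDr mxtraceD. Qed.

Lemma mdotZl (R : rcfType) (m n : nat) a (X Z : 'M[R[i]]_(m, n)) :
  mdot (a *: X) Z = a * mdot X Z.
Proof. by rewrite /mdot -scalemxAr mxtraceZ. Qed.

Lemma mdotC (R : rcfType) (m n : nat) (X Y : 'M[R[i]]_(m, n)) :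
  mdot Y X = conjc (mdot X Y).
Proof.
rewrite !mdotE rmorph_sum; apply: eq_bigr => i _.
rewrite rmorph_sum; apply: eq_bigr => j _ /=.
by rewrite rmorphM /= conjcK mulrC.
Qed.

Lemma mdotDr (R : rcfType) (m n : nat) (X Y Z : 'M[R[i]]_(m, n)) :
  mdot Z (X + Y) = mdot Z X + mdot Z Y.
Proof. by rewrite mdotC mdotDl rmorphD /= -!mdotC. Qed.

Lemma mdotZr (R : rcfType) (m n : nat) a (X Z : 'M[R[i]]_(m, n)) :
  mdot Z (a *: X) = conjc a * mdot Z X.
Proof. by rewrite mdotC mdotZl rmorphM /= -!mdotC. Qed.

(* The real inner product underlying the Hermitian one: all norm estimates
   below only involve real parts. *)
Definition ip (R : rcfType) (m n : nat) (X Y : 'M[R[i]]_(m, n)) : R :=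
  complex.Re (mdot X Y).

Lemma ipDl (R : rcfType) (m n : nat) (X Y Z : 'M[R[i]]_(m, n)) :
  ip (X + Y) Z = ip X Z + ip Y Z.
Proof. by rewrite /ip mdotDl raddfD. Qed.

Lemma ipC (R : rcfType) (m n : nat) (X Y : 'M[R[i]]_(m, n)) : ip X Y = ip Y X.
Proof. by rewrite /ip mdotC; case: (mdot Y X). Qed.

Lemma ipZl (R : rcfType) (m n : nat) (a : R) (X Z : 'M[R[i]]_(m, n)) :
  ip (a%:C%C *: X) Z = a * ip X Z.
Proof. by rewrite /ip mdotZl; case: (mdot X Z) => x y /=; rewrite mul0r subr0. Qed.

Lemma ipNl (R : rcfType) (m n : nat) (X Z : 'M[R[i]]_(m, n)) :
  ip (- X) Z = - ip X Z.
Proof. by rewrite /ip -scaleN1r mdotZl mulN1r raddfN. Qed.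

Lemma ipDr (R : rcfType) (m n : nat) (X Y Z : 'M[R[i]]_(m, n)) :
  ip Z (X + Y) = ip Z X + ip Z Y.
Proof. by rewrite ipC ipDl !(ipC _ Z). Qed.

Lemma ipNr (R : rcfType) (m n : nat) (X Z : 'M[R[i]]_(m, n)) :
  ip Z (- X) = - ip Z X.
Proof. by rewrite ipC ipNl ipC. Qed.

Lemma ipZr (R : rcfType) (m n : nat) (a : R) (X Z : 'M[R[i]]_(m, n)) :
  ip Z (a%:C%C *: X) = a * ip Z X.
Proof. by rewrite ipC ipZl ipC. Qed.

Lemma ip0r (R : rcfType) (m n : nat) (X : 'M[R[i]]_(m, n)) : ip X 0 = 0.
Proof. by rewrite ipC -(scale0r 0) /ip mdotZl mul0r. Qed.

Lemma ipE (R : rcfType) (m n : nat) (X : 'M[R[i]]_(m, n)) :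
  ip X X = \sum_i \sum_j (complex.Re (X i j) ^+ 2 + complex.Im (X i j) ^+ 2).
Proof.
rewrite /ip mdotE raddf_sum; apply: eq_bigr => i _.
rewrite raddf_sum; apply: eq_bigr => j _ /=.
by case: (X i j) => x y /=; rewrite mulrN opprK !expr2.
Qed.

Lemma ip_ge0 (R : rcfType) (m n : nat) (X : 'M[R[i]]_(m, n)) : 0 <= ip X X.
Proof.
by rewrite ipE; apply: sumr_ge0 => i _; apply: sumr_ge0 => j _; rewrite addr_ge0 ?sqr_ge0.
Qed.

Lemma entry_le_ip (R : rcfType) (m n : nat) (X : 'M[R[i]]_(m, n)) i j :
  complex.Re (X i j) ^+ 2 + complex.Im (X i j) ^+ 2 <= ip X X.
Proof.
rewrite ipE (bigD1 i) //= (bigD1 j) //= -addrA lerDl.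
by rewrite addr_ge0 //; repeat (apply: sumr_ge0 => ? _); rewrite addr_ge0 ?sqr_ge0.
Qed.

Lemma ip_eq0 (R : rcfType) (m n : nat) (X : 'M[R[i]]_(m, n)) : ip X X = 0 -> X = 0.
Proof.
move=> h; apply/matrixP => i j; rewrite mxE.
have := entry_le_ip X i j; rewrite h; case: (X i j) => x y /= le0.
have hx := sqr_ge0 x; have hy := sqr_ge0 y.
have /eqP : x ^+ 2 = 0 by lra.
have /eqP : y ^+ 2 = 0 by lra.
by rewrite !sqrf_eq0 => /eqP -> /eqP ->.
Qed.

Lemma mdot_xx (R : rcfType) (m n : nat) (X : 'M[R[i]]_(m, n)) :
  mdot X X = (ip X X)%:C%C.
Proof.
have := mdotC X X; rewrite /ip; case: (mdot X X) => x y /= [] e.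
by congr (_ +i* _)%C; lra.
Qed.

Lemma frob_ge0 (R : rcfType) (m n : nat) (X : 'M[R[i]]_(m, n)) : 0 <= frob X.
Proof. exact: sqrtr_ge0. Qed.

Lemma frob2 (R : rcfType) (m n : nat) (X : 'M[R[i]]_(m, n)) : frob X ^+ 2 = ip X X.
Proof. exact/sqr_sqrtr/ip_ge0. Qed.

Lemma frob_eq0 (R : rcfType) (m n : nat) (X : 'M[R[i]]_(m, n)) : frob X = 0 -> X = 0.
Proof. by move=> h; apply: ip_eq0; rewrite -frob2 h expr0n. Qed.

Lemma frob0 (R : rcfType) (m n : nat) : frob (0 : 'M[R[i]]_(m, n)) = 0.
Proof. by rewrite /frob /mdot mulmx0 mxtrace0 sqrtr0. Qed.

Lemma frobN (R : rcfType) (m n : nat) (X : 'M[R[i]]_(m, n)) : frob (- X) = frob X.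
Proof. by rewrite /frob -!/(ip _ _) ipNl ipNr opprK. Qed.

Lemma frobBC (R : rcfType) (m n : nat) (X Y : 'M[R[i]]_(m, n)) :
  frob (X - Y) = frob (Y - X).
Proof. by rewrite -frobN opprB. Qed.

Lemma frob_le (R : rcfType) (m n m' n' : nat) (X : 'M[R[i]]_(m, n)) (Y : 'M[R[i]]_(m', n')) :
  (frob X <= frob Y) = (ip X X <= ip Y Y).
Proof. by rewrite -!frob2 ler_sqr // nnegrE frob_ge0. Qed.

(* Optimise at [t = u / v]; for [u = 0] this is the first-order condition of a
   minimisation problem. *)
Lemma quadratic_bound (R : realFieldType) (d u v B : R) :
  0 <= u -> 0 <= v -> (v = 0 -> B <= 0) ->
  (forall t, 2 * t * B <= d * (u ^+ 2 + t ^+ 2 * v ^+ 2)) -> B <= d * u * v.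
Proof.
move=> u0 v0 vB h; have [v00|vn0] := eqVneq v 0.
  by rewrite v00 mulr0; apply: vB.
have vp : 0 < v by rewrite lt_def vn0.
have [u00|un0] := eqVneq u 0.
  rewrite u00 mulr0 mul0r leNgt; apply/negP => Bp.
  have [dle|dp] := leP d 0.
    have := h 1; rewrite u00; nra.
  have := h (B / (d * v ^+ 2)); rewrite u00 !expr2.
  have -> : 2 * (B / (d * (v * v))) * B = 2 * (B * B / (d * (v * v))) by ring.
  have -> : d * (0 * 0 + B / (d * (v * v)) * (B / (d * (v * v))) * (v * v))
     = B * B / (d * (v * v)) by field; rewrite vn0 gt_eqF.
  have : 0 < B * B / (d * (v * v)) by rewrite divr_gt0 // !mulr_gt0.
  lra.
have up : 0 < u by rewrite lt_def un0.
have := h (u / v).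
have -> : d * (u ^+ 2 + (u / v) ^+ 2 * v ^+ 2) = (u / v) * (2 * (d * u * v)) by field.
have -> : 2 * (u / v) * B = (u / v) * (2 * B) by ring.
by rewrite ler_pM2l ?divr_gt0 //; lra.
Qed.

(* [lra] and [nra] compare atoms up to conversion, which unfolds the matrix
   expressions inside norms; naming the norms first avoids this. *)
Ltac name_norms :=
  repeat match goal with H : ?P |- _ => match type of P with Prop => revert H end end;
  repeat match goal with
  | |- context [ip ?X ?Y] => let a := fresh in set a := (ip X Y); clearbody a
  | |- context [frob ?X] => let a := fresh in set a := (frob X); clearbody a
  | |- context [nuc ?X] => let a := fresh in set a := (nuc X); clearbody a
  end;
  intros.

(** Expanding [0 <= |X - t Y|^2] for all real [t] gives the hypothesis of [quadratic_bound] with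
    [d = 1]. *)
Lemma ip_cauchy (R : rcfType) (m n : nat) (X Y : 'M[R[i]]_(m, n)) :
  ip X Y <= frob X * frob Y.
Proof.
rewrite -[X in _ <= X * _]mul1r; apply: quadratic_bound; rewrite ?frob_ge0 //.
  by move=> /frob_eq0 ->; rewrite ip0r.
move=> t; rewrite !frob2.
have := ip_ge0 (X - t%:C%C *: Y).
rewrite !(ipDl, ipDr, ipNl, ipNr, ipZl, ipZr) (ipC Y X); name_norms; lra.
Qed.

Lemma frobD (R : rcfType) (m n : nat) (X Y : 'M[R[i]]_(m, n)) :
  frob (X + Y) <= frob X + frob Y.
Proof.
have p := frob_ge0 X; have q := frob_ge0 Y.
rewrite -ler_sqr ?nnegrE ?frob_ge0 ?addr_ge0 // frob2 !(ipDl, ipDr) (ipC Y X).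
have := ip_cauchy X Y; rewrite sqrrD -!frob2; name_norms; lra.
Qed.

Lemma frob_triangle (R : rcfType) (m n : nat) (Y X Z : 'M[R[i]]_(m, n)) :
  frob (X - Z) <= frob (X - Y) + frob (Y - Z).
Proof. by rewrite -[X in frob X <= _](_ : X - Y + (Y - Z) = _) ?frobD // addrA subrK. Qed.

(** * Spans of finite families and orthogonal projections *)

Lemma inspan_nil (R : rcfType) (m n : nat) (Y : 'M[R[i]]_(m, n)) :
  inspan [::] Y <-> Y = 0.
Proof.
split=> [[c ->]|->]; first by rewrite big_ord0.
by exists (fun=> 0); rewrite big_ord0.
Qed.

Lemma inspan_cons (R : rcfType) (m n : nat) (a : 'M[R[i]]_(m, n)) Psi Y :
  inspan (a :: Psi) Y <-> exists c Z, inspan Psi Z /\ Y = c *: a + Z.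
Proof.
split=> [[c ->]|[c [_ [[d ->] ->]]]].
  rewrite big_ord_recl /=; exists (c ord0), (\sum_(j < size Psi) c (lift ord0 j) *: Psi`_j).
  by split=> //; exists (fun j => c (lift ord0 j)).
exists (fun j => if unlift ord0 j is Some k then d k else c).
rewrite big_ord_recl /= unlift_none; congr (_ + _).
by apply: eq_bigr => j _; rewrite liftK.
Qed.

Lemma inspanZD (R : rcfType) (m n : nat) (Psi : seq 'M[R[i]]_(m, n)) c Y Z :
  inspan Psi Y -> inspan Psi Z -> inspan Psi (c *: Y + Z).
Proof.
move=> [d ->] [e ->]; exists (fun j => c * d j + e j).
by rewrite scaler_sumr -big_split; apply: eq_bigr => j _; rewrite /= scalerDl scalerA.
Qed.

Lemma inspan0 (R : rcfType) (m n : nat) (Psi : seq 'M[R[i]]_(m, n)) : inspan Psi 0.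
Proof. by exists (fun=> 0); rewrite big1 // => j _; rewrite scale0r. Qed.

Lemma inspanD (R : rcfType) (m n : nat) (Psi : seq 'M[R[i]]_(m, n)) Y Z :
  inspan Psi Y -> inspan Psi Z -> inspan Psi (Y + Z).
Proof. by move=> hY hZ; rewrite -[Y]scale1r; apply: inspanZD. Qed.

Lemma inspanZ (R : rcfType) (m n : nat) (Psi : seq 'M[R[i]]_(m, n)) c Y :
  inspan Psi Y -> inspan Psi (c *: Y).
Proof. by move=> hY; rewrite -[_ *: _]addr0; apply/inspanZD/inspan0. Qed.

Lemma inspanB (R : rcfType) (m n : nat) (Psi : seq 'M[R[i]]_(m, n)) Y Z :
  inspan Psi Y -> inspan Psi Z -> inspan Psi (Y - Z).
Proof. by move=> hY hZ; rewrite -scaleN1r addrC; apply: inspanZD. Qed.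

Lemma inspan_catr (R : rcfType) (m n : nat) (Phi Psi : seq 'M[R[i]]_(m, n)) Y :
  inspan Psi Y -> inspan (Phi ++ Psi) Y.
Proof.
elim: Phi => //= a Phi IH hY; apply/inspan_cons; exists 0, Y.
by rewrite scale0r add0r; split=> //; apply: IH.
Qed.

Lemma inspan_catl (R : rcfType) (m n : nat) (Phi Psi : seq 'M[R[i]]_(m, n)) Y :
  inspan Phi Y -> inspan (Phi ++ Psi) Y.
Proof.
elim: Phi Y => [|a Phi IH] Y; first by move/inspan_nil ->; apply: inspan0.
move=> /inspan_cons[c [Z [hZ ->]]]; apply/inspan_cons.
by exists c, Z; split=> //; apply: IH.
Qed.

Lemma rank_inspan (R : rcfType) (m n : nat) (Psi : seq 'M[R[i]]_(m, n)) Y :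
  (forall a, a \in Psi -> (\rank a <= 1)%N) -> inspan Psi Y ->
  (\rank Y <= size Psi)%N.
Proof.
elim: Psi Y => [|a Psi IH] Y h; first by move/inspan_nil ->; rewrite mxrank0.
move=> /inspan_cons[c [Z [hZ ->]]]; apply: leq_trans (mxrank_add _ _) _.
rewrite /= -add1n leq_add //.
  by rewrite (leq_trans (mxrank_scale _ _)) ?h ?mem_head.
by apply: IH => // b hb; apply: h; rewrite inE hb orbT.
Qed.

Lemma rank_admissible (R : rcfType) (m n k : nat) (O : set 'M[R[i]]_(m, n)) Psi Y :
  atoms O -> admissible O k Psi -> inspan Psi Y -> (\rank Y <= k)%N.
Proof.
move=> [rk1 _] [PsiO szPsi] hY; apply: leq_trans szPsi.
by apply: rank_inspan hY => a /PsiO /rk1[->].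
Qed.

(** Gram-Schmidt, by induction on the family: the new element [a] is replaced by its component
    [a - Q] orthogonal to the span of the others. *)
Lemma proj_exists (R : rcfType) (m n : nat) (Psi : seq 'M[R[i]]_(m, n)) X :
  exists Y, inspan Psi Y /\ forall Z, inspan Psi Z -> mdot (X - Y) Z = 0.
Proof.
elim: Psi X => [|a Psi IH] X.
  exists 0; split; first exact: inspan0.
  by move=> Z /inspan_nil ->; rewrite -(scale0r 0) mdotZr conjc0 mul0r.
have [P [hP oP]] := IH X; have [Q [hQ oQ]] := IH a.
(* If [a] already lies in the span of [Psi], the projection does not change. *)
have [e|nz] := eqVneq (mdot (a - Q) (a - Q)) 0.
  have /eqP : a - Q = 0 by apply: ip_eq0; rewrite /ip e.
  rewrite subr_eq0 => /eqP ->; exists P; split.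
    by apply/inspan_cons; exists 0, P; rewrite scale0r add0r.
  by move=> Z /inspan_cons[c [W [hW ->]]]; apply: oP; apply: inspanZD.
pose t := mdot X (a - Q) / mdot (a - Q) (a - Q).
have cP Z c : inspan Psi Z -> inspan (a :: Psi) (c *: a + Z).
  by move=> hZ; apply/inspan_cons; exists c, Z.
have cP' Z : inspan Psi Z -> inspan (a :: Psi) Z.
  by move=> /(cP Z 0); rewrite scale0r add0r.
exists (t *: (a - Q) + P); split.
  apply: inspanZD; last exact: cP'.
  have hQN : inspan Psi (- Q) by rewrite -scaleN1r; apply: inspanZ.
  by have := cP _ 1 hQN; rewrite scale1r.
have oT Z : inspan Psi Z -> mdot (X - (t *: (a - Q) + P)) Z = 0.
  move=> hZ; rewrite opprD addrCA addrC -scaleNr mdotDl mdotZl oQ // mulr0 addr0.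
  exact: oP.
move=> Z /inspan_cons[c [W [hW ->]]].
(* Split into a part in the span of [Psi], settled by [oT], and a multiple of [a - Q], for which [t]
   was chosen. *)
have -> : c *: a + W = c *: (a - Q) + (c *: Q + W) by rewrite scalerBr addrA subrK.
rewrite mdotDr (oT (c *: Q + W)) ?addr0; last exact: inspanZD.
rewrite mdotZr opprD addrA -scaleNr mdotDl mdotDl mdotZl.
rewrite mulNr divfK // subrr add0r -scaleN1r mdotZl.
by rewrite (mdotC _ P) oQ // conjc0 !mulr0.
Qed.

Lemma inspan_proj (R : rcfType) (m n : nat) (Psi : seq 'M[R[i]]_(m, n)) X :
  inspan Psi (proj Psi X).
Proof. by have [] := epsilon_spec (inhabits 0) _ (proj_exists Psi X). Qed.

Lemma proj_orth (R : rcfType) (m n : nat) (Psi : seq 'M[R[i]]_(m, n)) X Z :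
  inspan Psi Z -> ip (X - proj Psi X) Z = 0.
Proof.
have [_ h] := epsilon_spec (inhabits 0) _ (proj_exists Psi X).
by move=> /h; rewrite -/(proj Psi X) /ip => ->.
Qed.

Lemma proj_pythagoras (R : rcfType) (m n : nat) (Psi : seq 'M[R[i]]_(m, n)) X Z :
  inspan Psi Z ->
  ip (X - Z) (X - Z) = ip (X - proj Psi X) (X - proj Psi X)
                       + ip (proj Psi X - Z) (proj Psi X - Z).
Proof.
move=> hZ.
have -> : X - Z = (X - proj Psi X) + (proj Psi X - Z) by rewrite addrA subrK.
have : ip (X - proj Psi X) (proj Psi X - Z) = 0.
  by apply: proj_orth; apply: inspanB => //; apply: inspan_proj.
move: (X - _) (_ - Z) => U V o.
by rewrite !(ipDl, ipDr) (ipC V U) o addr0 add0r.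
Qed.

Lemma proj_min (R : rcfType) (m n : nat) (Psi : seq 'M[R[i]]_(m, n)) X Z :
  inspan Psi Z -> frob (X - proj Psi X) <= frob (X - Z).
Proof. by move=> /proj_pythagoras h; rewrite frob_le h lerDl ip_ge0. Qed.

(** * Low-rank matrices as combinations of atoms *)

Lemma mulmx_sum_col_row (R : pzRingType) (m n k : nat) (A : 'M[R]_(m, k)) (B : 'M[R]_(k, n)) :
  A *m B = \sum_j col j A *m row j B.
Proof.
apply/matrixP => i l; rewrite summxE mxE; apply: eq_bigr => j _.
by rewrite mxE big_ord1 !mxE.
Qed.

Lemma rank_le1_inspan_atom (R : rcfType) (m n : nat) (O : set 'M[R[i]]_(m, n)) M :
  atoms O -> (\rank M <= 1)%N -> exists Psi, admissible O 1 Psi /\ inspan Psi M.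
Proof.
move=> [_ hO]; rewrite leq_eqVlt => /orP[/eqP/hO[a [[Oa [c ->]] _]]|].
  exists [:: a]; split; first by split=> // b; rewrite inE => /eqP ->.
  by apply/inspan_cons; exists c, 0; rewrite addr0; split=> //; apply/inspan_nil.
rewrite ltnS leqn0 mxrank_eq0 => /eqP ->; exists [::].
by split; [split|apply: inspan0].
Qed.

(** A rank factorisation writes [Z] as a sum of [\rank Z] products of a column and a row, each a
    multiple of an atom. This turns optimality over sets of atoms into optimality over matrices of
    bounded rank. *)
Lemma low_rank_inspan_atoms (R : rcfType) (m n k : nat) (O : set 'M[R[i]]_(m, n)) Z :
  atoms O -> (\rank Z <= k)%N -> exists Psi, admissible O k Psi /\ inspan Psi Z.
Proof.
move=> hO rkZ.
have sum_rank1 : forall l (M : 'I_l -> 'M[R[i]]_(m, n)), (forall j, \rank (M j) <= 1)%N ->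
    exists Psi, admissible O l Psi /\ inspan Psi (\sum_j M j).
  elim=> [|l IH] M rkM.
    by exists [::]; rewrite big_ord0; split; [split|apply: inspan0].
  rewrite big_ord_recl.
  have [Psi [[PsiO szPsi] hPsi]] := rank_le1_inspan_atom hO (rkM ord0).
  have [Phi [[PhiO szPhi] hPhi]] := IH _ (fun j => rkM (lift ord0 j)).
  exists (Psi ++ Phi); split; first split.
  - by move=> a; rewrite mem_cat => /orP[/PsiO|/PhiO].
  - by rewrite size_cat -add1n leq_add.
  - by apply: inspanD; [apply: inspan_catl|apply: inspan_catr].
have [|Psi [[PsiO szPsi]]] :=
  sum_rank1 _ (fun j : 'I_(\rank Z) => col j (col_base Z) *m row j (row_base Z)).
  by move=> j; rewrite (leq_trans (mxrankM_maxr _ _)) // rank_leq_row.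
rewrite -mulmx_sum_col_row mulmx_base => hZ.
by exists Psi; split=> //; split=> //; apply: leq_trans szPsi _.
Qed.

(* By Pythagoras, maximising the projection minimises the residual. *)
Lemma best_atoms_approx (R : rcfType) (m n k : nat) (O : set 'M[R[i]]_(m, n)) Psi Y Z :
  atoms O ->
  (forall Phi, admissible O k Phi -> frob (proj Phi Y) <= frob (proj Psi Y)) ->
  (\rank Z <= k)%N -> frob (Y - proj Psi Y) <= frob (Y - Z).
Proof.
move=> hO best rkZ; have [Phi [aPhi hZ]] := low_rank_inspan_atoms hO rkZ.
apply: le_trans (proj_min Y hZ).
move/best: aPhi; rewrite !frob_le.
have := proj_pythagoras Y (inspan0 Phi).
have := proj_pythagoras Y (inspan0 Psi).
rewrite !subr0; name_norms; lra.
Qed.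

(** * Linear operators: adjoint and boundedness *)

Lemma mdot_suml (R : rcfType) (m n : nat) I (s : seq I) (F : I -> 'M[R[i]]_(m, n)) Y :
  mdot (\sum_(i <- s) F i) Y = \sum_(i <- s) mdot (F i) Y.
Proof.
apply: (big_morph (fun X => mdot X Y)); first by move=> X Z; rewrite mdotDl.
by rewrite -(scale0r 0) mdotZl mul0r.
Qed.

Lemma frob_sum (R : rcfType) (m n : nat) I (s : seq I) (F : I -> 'M[R[i]]_(m, n)) :
  frob (\sum_(i <- s) F i) <= \sum_(i <- s) frob (F i).
Proof.
elim: s => [|i s IH]; first by rewrite !big_nil frob0.
by rewrite !big_cons (le_trans (frobD _ _)) // lerD2l.
Qed.

Lemma adjP (R : rcfType) (m n p : nat) (A : {linear 'M[R[i]]_(m, n) -> 'cV[R[i]]_p}) y X :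
  ip (A X) y = ip X (adj A y).
Proof.
have adj_exists : exists Z, forall X, vdot (A X) y = mdot X Z.
  (* The entries of the adjoint are forced by testing on the matrix units. *)
  exists (\matrix_(i, j) conjc (mdot (A (delta_mx i j)) y)) => W.
  rewrite vdot_mdot [RHS]mdotE {1}(matrix_sum_delta W) linear_sum /= mdot_suml.
  apply: eq_bigr => i _; rewrite linear_sum /= mdot_suml; apply: eq_bigr => j _.
  by rewrite linearZ /= mdotZl mxE conjcK.
have := epsilon_spec (inhabits 0) _ adj_exists X.
by rewrite vdot_mdot /ip => ->.
Qed.

Lemma frobZ_entry (R : rcfType) (m n k l : nat) (X : 'M[R[i]]_(m, n)) i j
  (M : 'M[R[i]]_(k, l)) : frob (X i j *: M) <= frob X * frob M.
Proof.
rewrite -ler_sqr ?nnegrE ?mulr_ge0 ?frob_ge0 // exprMn !frob2.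
apply: le_trans (ler_wpM2r (ip_ge0 M) (entry_le_ip X i j)).
rewrite /ip mdotZl mdotZr mdot_xx; case: (X i j) => x y /=.
by rewrite le_eqVlt; apply/orP; left; apply/eqP; ring.
Qed.

Lemma linear_bounded (R : rcfType) (m n p : nat)
  (A : {linear 'M[R[i]]_(m, n) -> 'cV[R[i]]_p}) :
  exists2 K, 0 <= K & forall X, frob (A X) <= K * frob X.
Proof.
exists (\sum_i \sum_j frob (A (delta_mx i j))).
  by do 2! [apply: sumr_ge0 => ? _]; apply: frob_ge0.
move=> X; rewrite {1}(matrix_sum_delta X) linear_sum mulrC mulr_sumr.
apply: le_trans (frob_sum _ _) _; apply: ler_sum => i _.
rewrite linear_sum /= mulr_sumr.
apply: le_trans (frob_sum _ _) _; apply: ler_sum => j _.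
by rewrite linearZ /= frobZ_entry.
Qed.

(** * The restricted isometry property *)

Definition rip (R : rcfType) (m n p : nat)
    (A : 'M[R[i]]_(m, n) -> 'cV[R[i]]_p) (s : nat) (d : R) : Prop :=
  forall X : 'M[R[i]]_(m, n), (\rank X <= s)%N ->
    (1 - d) * ip X X <= ip (A X) (A X) <= (1 + d) * ip X X.

(* The infimum defining [ric] is attained; the set is nonempty since [A] is
   bounded (otherwise [inf] would be the junk value [0]). *)
Lemma ric_rip (R : realType) (m n p s : nat)
  (A : {linear 'M[R[i]]_(m, n) -> 'cV[R[i]]_p}) (d : R) :
  ric A s <= d -> rip A s d.
Proof.
move=> hd X rkX.
pose S := [set d : R | 0 <= d /\ forall X : 'M[R[i]]_(m, n), (\rank X <= s)%N ->
          (1 - d) * frob X ^+ 2 <= norm2 (A X) ^+ 2 <= (1 + d) * frob X ^+ 2]%classic.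
have infS : has_inf S.
  split; last by exists 0 => x [].
  have [K K0 hK] := linear_bounded A; exists (1 + K ^+ 2); split.
    by rewrite addr_ge0 ?sqr_ge0.
  move=> Z _; rewrite norm2_frob.
  have h : frob (A Z) ^+ 2 <= K ^+ 2 * frob Z ^+ 2.
    by rewrite -exprMn ler_sqr ?nnegrE ?mulr_ge0 ?frob_ge0.
  have hz := sqr_ge0 (frob Z); have ha := sqr_ge0 (frob (A Z)).
  have hk := sqr_ge0 K; apply/andP; split; name_norms; nra.
(* Some element of [S] lies below the infimum plus [e], hence below [d + e]. *)
have near e : 0 < e ->
    (1 - (d + e)) * ip X X <= ip (A X) (A X) <= (1 + (d + e)) * ip X X.
  move=> /(inf_adherent)/(_ infS)[d' [_ /(_ X rkX)]].
  rewrite norm2_frob !frob2 => /andP[h1 h2] lt.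
  have le : d' <= d + e by move: hd; rewrite /ric -/S; name_norms; lra.
  have q := ip_ge0 X; apply/andP; split; name_norms; nra.
have q := ip_ge0 X.
(* Rescaled slack, so that the error after multiplication by [ip X X] is at most [e]; the added 1
   covers [X = 0]. *)
have eP e : 0 < e -> 0 < e / (ip X X + 1) /\ e / (ip X X + 1) * ip X X <= e.
  move=> e0; split; first by rewrite divr_gt0 //; lra.
  by rewrite mulrAC ler_pdivrMr; name_norms; nra.
apply/andP; split; apply/ler_addgt0Pr => e /eP[/near/andP[h1 h2] h3]; name_norms; nra.
Qed.

(** The constant comes from [(51/50)^2 = 1.0404 >= 1 + 4/100]. *)
Lemma rip_frob (R : rcfType) (m n p s : nat)
  (A : {linear 'M[R[i]]_(m, n) -> 'cV[R[i]]_p}) X :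
  rip A s (4 / 100) -> (\rank X <= s)%N -> frob (A X) <= 51 / 50 * frob X.
Proof.
move=> ripA /ripA /andP[_ h]; have x0 := frob_ge0 X.
rewrite -ler_sqr ?nnegrE ?frob_ge0 ?mulr_ge0 //; last (name_norms; lra).
by rewrite exprMn !frob2; have := ip_ge0 X; name_norms; lra.
Qed.

(** Polarisation: adding the lower isometry bound at [U + t V] and the upper one at [U - t V]
    cancels the squares of the images and leaves the hypothesis of [quadratic_bound]. *)
Lemma rip_polar (R : rcfType) (m n p s : nat)
  (A : {linear 'M[R[i]]_(m, n) -> 'cV[R[i]]_p}) d U V :
  rip A s d -> (forall t : R, (\rank (U + t%:C%C *: V)%R <= s)%N) ->
  ip U V - ip (A U) (A V) <= d * frob U * frob V.
Proof.
move=> ripA rk; apply: quadratic_bound; rewrite ?frob_ge0 //.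
  by move=> /frob_eq0 ->; rewrite raddf0 !ip0r subr0.
move=> t; rewrite !frob2.
have /andP[h1 _] := ripA _ (rk t); have /andP[_] := ripA _ (rk (- t)); move: h1.
rewrite !linearD !linearZ !(ipDl, ipDr, ipZl, ipZr) (ipC V U) (ipC (A V) (A U)).
name_norms; nra.
Qed.

(** * Errors of the identification and least-squares steps *)

Lemma rank_comb (F : fieldType) (m n : nat) (X Y : 'M[F]_(m, n)) a b k l :
  (\rank X <= k)%N -> (\rank Y <= l)%N -> (\rank (a *: X + b *: Y)%R <= k + l)%N.
Proof.
move=> hX hY; apply: leq_trans (mxrank_add _ _) (leq_add _ _).
  exact: leq_trans (mxrank_scale _ _) hX.
exact: leq_trans (mxrank_scale _ _) hY.
Qed.

Lemma le_of_sqr_le (R : realFieldType) (x c : R) : 0 <= x -> 0 <= c -> x ^+ 2 <= c * x -> x <= c.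
Proof.
move=> x0 c0 h; have [->//|xn0] := eqVneq x 0.
by move: h; rewrite expr2 ler_pM2r // lt_def xn0.
Qed.

(* Instead of comparing supports, only use that the best approximation [Y'] of
   the proxy [Y] is at least as good as the approximation by [E] itself. *)
Lemma identification (R : rcfType) (m n p r : nat)
  (A : {linear 'M[R[i]]_(m, n) -> 'cV[R[i]]_p}) (E Y' : 'M[R[i]]_(m, n)) nu :
  rip A (4 * r) (4 / 100) -> (\rank E <= 2 * r)%N -> (\rank Y' <= 2 * r)%N ->
  (let Y := adj A (A E + nu) in frob (Y - Y') <= frob (Y - E)) ->
  frob (E - Y') <= 8 / 100 * frob E + 51 / 25 * frob nu.
Proof.
move=> ripA rkE rkY' /=; set Y := adj A _; rewrite (frobBC E); set W := Y' - E => best.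
have rkC (a b : R[i]) : (\rank (a *: E + b *: Y')%R <= 4 * r)%N.
  by rewrite (leq_trans (rank_comb _ _ rkE rkY')) // -mulnDl.
have rk (t : R) : (\rank (E + t%:C%C *: - W)%R <= 4 * r)%N.
  have -> : E + t%:C%C *: - W = (1 + t%:C%C) *: E + (- t%:C%C) *: Y'; last exact: rkC.
  by rewrite /W scalerN scalerBr scalerDl scale1r opprB scaleNr addrA.
have rkW : (\rank W <= 4 * r)%N.
  by have := rkC (-1) 1; rewrite scale1r scaleN1r addrC.
(* The direction is [- W] since [<A E, A W> - <E, W>] must be bounded from above. *)
have polar := rip_polar ripA rk.
have cauchy := ip_cauchy (A W) nu; have bdW := rip_frob ripA rkW.
have adjW := adjP A (A E + nu) W; rewrite -/Y ipDr in adjW.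
have eY : Y - Y' = (Y - E) - W by rewrite /W opprB addrA subrK.
clearbody W Y.
have w0 := frob_ge0 W; have e0 := frob_ge0 E; have n0 := frob_ge0 nu.
(* Square [|Y - E - W| <= |Y - E|] and cancel [|Y - E|^2]. *)
have Ycmp : ip W W <= 2 * (ip W Y - ip W E).
  move: best; rewrite frob_le eY.
  rewrite !(ipDl, ipDr, ipNl, ipNr) (ipC Y W) (ipC E W); name_norms; lra.
move: polar; rewrite raddfN frobN !ipNr opprK (ipC E W) (ipC _ (A W)) => polar.
have cw : frob (A W) * frob nu <= 51 / 50 * frob W * frob nu by apply: ler_wpM2r.
(* Together: [|W|^2 <= 2 (4/100 |E| + 51/50 |nu|) |W|]; one factor [|W|] cancels. *)
apply: le_of_sqr_le => //; first (name_norms; lra).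
rewrite frob2; name_norms; nra.
Qed.

(** First-order condition: comparing [Xt] with [Xt + t Z] for all real [t] is [quadratic_bound] with
    [d = 1] and [u = 0]. Since [- Z] lies in the span too, this yields the real normal equations. *)
Lemma least_squares_orth (R : rcfType) (m n p : nat)
  (A : {linear 'M[R[i]]_(m, n) -> 'cV[R[i]]_p}) b Psi Xt Z :
  inspan Psi Xt -> (forall X, inspan Psi X -> norm2 (b - A Xt) <= norm2 (b - A X)) ->
  inspan Psi Z -> ip (b - A Xt) (A Z) <= 0.
Proof.
move=> hXt min hZ.
have -> : 0 = 1 * 0 * frob (A Z) :> R by rewrite mulr0 mul0r.
apply: quadratic_bound; rewrite ?frob_ge0 //.
  by move=> /frob_eq0 ->; rewrite ip0r.
move=> t; have := min (t%:C%C *: Z + Xt) (inspanZD _ hZ hXt).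
rewrite !norm2_frob frob_le linearD linearZ frob2.
have -> : b - (t%:C%C *: A Z + A Xt) = (b - A Xt) - t%:C%C *: A Z.
  by rewrite opprD addrCA addrC.
move: (b - A Xt) (A Z) => U V.
rewrite !(ipDl, ipDr, ipNl, ipNr, ipZl, ipZr) (ipC V U); name_norms; lra.
Qed.

Lemma least_squares_error (R : rcfType) (m n p s : nat)
  (A : {linear 'M[R[i]]_(m, n) -> 'cV[R[i]]_p}) (X : 'M[R[i]]_(m, n)) nu Psi Xt :
  rip A s (4 / 100) ->
  (forall Z, inspan Psi Z -> (\rank (X + Z)%R <= s)%N) ->
  (forall Z, inspan Psi Z -> (\rank Z <= s)%N) ->
  inspan Psi Xt ->
  (forall Z, inspan Psi Z -> norm2 (A X + nu - A Xt) <= norm2 (A X + nu - A Z)) ->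
  96 / 100 * frob (X - Xt) <= frob (X - proj Psi X) + 51 / 50 * frob nu.
Proof.
move=> ripA rkX rkPsi hXt min; set P := proj Psi X; pose W := P - Xt.
have hW : inspan Psi W by apply: inspanB => //; apply: inspan_proj.
have orth := proj_orth X hW; have lso := least_squares_orth hXt min hW.
have hNW : inspan Psi (- W) by rewrite -scaleN1r; apply: inspanZ.
have lsoN := least_squares_orth hXt min hNW.
have rk (t : R) : (\rank (X - Xt + t%:C%C *: W)%R <= s)%N.
  by rewrite -addrA; apply/rkX; rewrite addrC; apply: inspanB => //; apply: inspanZ.
have polar := rip_polar ripA rk.
have cauchy := ip_cauchy nu (A (- W)); have bdW := rip_frob ripA (rkPsi _ hNW).
have tri := frob_triangle P X Xt; rewrite -/W in tri.
have w0 := frob_ge0 W; have e0 := frob_ge0 (X - Xt); have n0 := frob_ge0 nu.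
have eA : A X + nu - A Xt = A (X - Xt) + nu by rewrite linearB /= addrAC.
have eW : ip W W = ip (X - Xt) W.
  have -> : X - Xt = (X - P) + W by rewrite /W addrA subrK.
  by rewrite ipDl orth add0r.
clearbody W.
move: lso lsoN bdW cauchy; rewrite eA raddfN frobN !ipNr !ipDl frobN => lso lsoN bdW cauchy.
have cw : frob nu * frob (A W) <= frob nu * (51 / 50 * frob W) by apply: ler_wpM2l.
(* By orthogonality [|W|^2 = <X - Xt, W>]. Polarisation replaces this by [<A (X - Xt), A W>], which
   the normal equations bound by [- <nu, A W>]. *)
have : frob W <= 4 / 100 * frob (X - Xt) + 51 / 50 * frob nu.
  apply: le_of_sqr_le => //; first (name_norms; lra).
  rewrite frob2 eW; name_norms; nra.
(* Triangle inequality through [P]; the term [4/100 |X - Xt|] is absorbed on the left. *)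
name_norms; lra.
Qed.

(** * Orthogonal rank-one sums and their splitting into blocks *)

Lemma ip_suml (R : rcfType) (m n : nat) I (s : seq I) (F : I -> 'M[R[i]]_(m, n)) Y :
  ip (\sum_(i <- s) F i) Y = \sum_(i <- s) ip (F i) Y.
Proof. by rewrite /ip mdot_suml raddf_sum. Qed.

Lemma ip_sum_orth (R : rcfType) (m n : nat) (I : eqType) (N : I -> 'M[R[i]]_(m, n)) (s : seq I) :
  (forall j k, j != k -> ip (N j) (N k) = 0) -> uniq s ->
  ip (\sum_(j <- s) N j) (\sum_(j <- s) N j) = \sum_(j <- s) ip (N j) (N j).
Proof.
move=> orth; elim: s => [|a s IH] /=; first by rewrite !big_nil ip0r.
move=> /andP[as_ us]; rewrite !big_cons !(ipDl, ipDr) IH //.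
rewrite (ipC (N a)) !ip_suml big1_seq ?add0r ?addr0 // => j /= js.
by apply: orth; apply: contraNneq as_ => <-.
Qed.

Lemma rank_sum_rank1 (F : fieldType) (m n : nat) (I : Type) (N : I -> 'M[F]_(m, n)) (s : seq I) :
  (forall j, \rank (N j) <= 1)%N -> (\rank (\sum_(j <- s) N j)%R <= size s)%N.
Proof.
move=> rk1; elim: s => [|a s IH]; first by rewrite big_nil mxrank0.
by rewrite big_cons (leq_trans (mxrank_add _ _)) //= -add1n leq_add.
Qed.

(* In decreasing order, every term of a block of length [r] is at most the mean
   of the previous block, so the Frobenius norm of a block is at most [1 / sqrt r]
   times the sum of the norms in the previous one. *)
Lemma block_bound (R : rcfType) (m n p r : nat) (I : eqType)
  (A : {linear 'M[R[i]]_(m, n) -> 'cV[R[i]]_p}) (c : R)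
  (N : I -> 'M[R[i]]_(m, n)) (s : seq I) :
  (0 < r)%N -> 0 <= c ->
  (forall X, (\rank X <= r)%N -> frob (A X) <= c * frob X) ->
  (forall j, \rank (N j) <= 1)%N ->
  (forall j k, j != k -> ip (N j) (N k) = 0) ->
  uniq s -> pairwise (fun j k => frob (N k) <= frob (N j)) s ->
  frob (A (\sum_(j <- s) N j)) <=
  c * (frob (\sum_(j <- take r s) N j)
       + (Num.sqrt (r%:R : R))^-1 * \sum_(j <- s) frob (N j)).
Proof.
(* Strong induction on the length, since the tail is shorter by [r] terms. *)
move=> r0 c0 bdA rk1 orth; have [l le_sl] := ubnP (size s).
elim: l s le_sl => // l IH s; rewrite ltnS => le_sl us ps.
set q := Num.sqrt _; have r0' : 0 < r%:R :> R by rewrite ltr0n.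
have q0 : 0 < q by rewrite sqrtr_gt0.
have sum0 (u : seq I) : 0 <= \sum_(j <- u) frob (N j).
  by apply: sumr_ge0 => j _; apply: frob_ge0.
have rkB : (\rank (\sum_(j <- take r s) N j)%R <= r)%N.
  by rewrite (leq_trans (rank_sum_rank1 _ rk1)) // size_take_min geq_minl.
have bdB := bdA _ rkB.
have [le_sr|lt_rs] := leqP (size s) r.
  rewrite take_oversize // in bdB *; apply: le_trans bdB _; apply: ler_wpM2l => //.
  by rewrite lerDl mulr_ge0 // invr_ge0 ltW.
have split_sum (V : nmodType) (f : I -> V) :
    \sum_(j <- s) f j = \sum_(j <- take r s) f j + \sum_(j <- drop r s) f j.
  by rewrite -{1}(cat_take_drop r s) big_cat.
move: us ps; rewrite -{1 2}(cat_take_drop r s) cat_uniq pairwise_cat !split_sum.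
have szB : size (take r s) = r by rewrite size_takel // ltnW.
have szT : (size (drop r s) < l)%N.
  by rewrite size_drop (leq_trans _ le_sl) // ltn_subrL r0 (leq_ltn_trans _ lt_rs).
move: (take r s) (drop r s) bdB szB szT => B T bdB szB szT.
move=> /and3P[_ _ uT] /and3P[/allrelP BT _ pT].
have {IH}bdT := IH T szT uT pT; rewrite -/q in bdT.
have mean k : k \in T -> r%:R * frob (N k) <= \sum_(j <- B) frob (N j).
  move=> kT; rewrite -szB mulr_natl -iter_addr_0 -[size B]count_predT -big_const_seq.
  by rewrite big_seq [leRHS]big_seq; apply: ler_sum => j jB; apply: BT.
have bdhead : frob (\sum_(j <- take r T) N j) <= q^-1 * \sum_(j <- B) frob (N j).
  rewrite -ler_sqr ?nnegrE ?frob_ge0 ?mulr_ge0 ?invr_ge0 ?(ltW q0) //.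
  rewrite frob2 ip_sum_orth ?take_uniq // exprMn exprVn sqr_sqrtr ?(ltW r0') //.
  set S := \sum_(j <- B) _.
  apply: (@le_trans _ _ (\sum_(j <- take r T) (S / r%:R) ^+ 2)).
    rewrite big_seq [leRHS]big_seq; apply: ler_sum => j /mem_take jT.
    rewrite -frob2 ler_sqr ?nnegrE ?frob_ge0 ?divr_ge0 ?sum0 ?(ltW r0') //.
    by rewrite ler_pdivlMr // mulrC mean.
  rewrite big_const_seq count_predT iter_addr_0 -[_ *+ size _]mulr_natl.
  have -> : r%:R^-1 * S ^+ 2 = r%:R * (S / r%:R) ^+ 2 by field; rewrite gt_eqF.
  by rewrite ler_wpM2r ?sqr_ge0 // ler_nat size_take_min geq_minl.
(* The head of the tail is charged to the sum over [B], and the induction bound already charges the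
   sum over [T]; together these give the sum over [s], each term once. *)
rewrite linearD; apply: le_trans (frobD _ _) _.
apply: le_trans (lerD bdB bdT) _.
rewrite -mulrDr; apply: ler_wpM2l => //; rewrite mulrDr; name_norms; lra.
Qed.

(** * Singular value decomposition and the nuclear norm *)

Lemma mxHM (R : rcfType) (m n k : nat) (X : 'M[R[i]]_(m, n)) (Y : 'M[R[i]]_(n, k)) :
  mxH (X *m Y) = mxH Y *m mxH X.
Proof. by rewrite /mxH map_mxM trmx_mul. Qed.

Lemma mxHK (R : rcfType) (m n : nat) (X : 'M[R[i]]_(m, n)) : mxH (mxH X) = X.
Proof. by apply/matrixP => i j; rewrite !mxE conjcK. Qed.

Lemma mxH_delta (R : rcfType) (m n : nat) i j :
  mxH (delta_mx i j : 'M[R[i]]_(m, n)) = delta_mx j i.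
Proof. by apply/matrixP => k l; rewrite !mxE conjc_nat andbC. Qed.

Lemma mxH_conjC (R : rcfType) (m n : nat) (X : 'M[R[i]]_(m, n)) :
  mxH X = map_mx Num.conj X^T.
Proof. by rewrite /mxH map_trmx. Qed.

(** [D^H D] is Hermitian, hence normal, so the spectral theorem diagonalises it by a unitary
    matrix. *)
Lemma gram_spectral (R : rcfType) (m n : nat) (D : 'M[R[i]]_(m, n)) :
  exists (P : 'M[R[i]]_n) (sp : 'rV[R[i]]_n),
    [/\ P *m mxH P = 1%:M, mxH P *m P = 1%:M & mxH D *m D = mxH P *m diag_mx sp *m P].
Proof.
set M := mxH D *m D.
have /orthomx_spectralP eM : M \is normalmx.
  by apply/normalmxP; rewrite -mxH_conjC /M mxHM mxHK.
have uP := spectral_unitarymx M.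
exists (spectralmx M), (spectral_diag M).
move: eM; rewrite (invmx_unitary uP) -(mxH_conjC (spectralmx M)) => eM.
have PP : spectralmx M *m mxH (spectralmx M) = 1%:M.
  by rewrite mxH_conjC; apply/unitarymxP.
by split=> //; apply: mulmx1C PP.
Qed.

Lemma char_poly_similar (F : comNzRingType) (n : nat) (P Q M : 'M[F]_n) :
  Q *m P = 1%:M -> char_poly (Q *m M *m P) = char_poly M.
Proof.
move=> QP; have PQ := mulmx1C QP.
have mQP : map_mx (@polyC F) Q *m map_mx (@polyC F) P = 1%:M.
  by rewrite -map_mxM QP map_mx1.
have -> : char_poly (Q *m M *m P)
    = \det (map_mx (@polyC F) Q *m char_poly_mx M *m map_mx (@polyC F) P).
  rewrite /char_poly /char_poly_mx !map_mxM mulmxBr mulmxBl; congr (\det (_ - _)).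
  by rewrite scalar_mxC -mulmxA mQP mulmx1.
by rewrite !det_mulmx mulrAC -det_mulmx mQP det1 mul1r.
Qed.

(* With [v_j] the eigenvectors of [D^H D], take [N j = D v_j v_j^H]. *)
Lemma svd_terms (R : rcfType) (m n : nat) (D : 'M[R[i]]_(m, n)) :
  exists N : 'I_n -> 'M[R[i]]_(m, n),
    [/\ D = \sum_j N j, forall j, (\rank (N j) <= 1)%N,
        forall j k, j != k -> ip (N j) (N k) = 0 & nuc D = \sum_j frob (N j)].
Proof.
have [P [sp [PP' P'P eM]]] := gram_spectral D.
pose N j := D *m mxH P *m delta_mx j j *m P.
(* By cyclicity of the trace and unitarity of [P], only entries of the diagonal matrix remain. *)
have dotN j k : mdot (N j) (N k) = if j == k then sp 0 j else 0.
  rewrite /mdot /N !mxHM mxHK mxH_delta.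
  have -> : mxH P *m (delta_mx k k *m (P *m mxH D)) *m (D *m mxH P *m delta_mx j j *m P)
     = mxH P *m (delta_mx k k *m P *m (mxH D *m D) *m mxH P *m delta_mx j j *m P).
    by rewrite !mulmxA.
  rewrite mxtrace_mulC eM !mulmxA -!(mulmxA _ P (mxH P)) PP' !mulmx1.
  rewrite -mulmxA mul_diag_mx /mxtrace (bigD1 k) //= big1 ?addr0.
    rewrite mxE (bigD1 k) //= big1 ?addr0 => [|l lk]; last by rewrite !mxE eqxx (negbTE lk) mul0r.
    by rewrite !mxE !eqxx mul1r eq_sym; case: eqVneq => [->|]; rewrite ?mulr1 ?mulr0.
  by move=> l lk; rewrite mxE big1 // => l' _; rewrite !mxE (negbTE lk) mul0r.
exists N; split.
- rewrite -mulmx_suml -mulmx_sumr.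
  have -> : \sum_j delta_mx j j = 1%:M :> 'M[R[i]]_n.
    apply/matrixP => a b; rewrite summxE (bigD1 a) //= big1 ?addr0 => [|l la].
      by rewrite !mxE eqxx eq_sym.
    by rewrite mxE eq_sym (negbTE la).
  by rewrite mulmx1 -mulmxA P'P mulmx1.
- move=> j; apply: leq_trans (mxrankM_maxl _ _) _.
  by apply: leq_trans (mxrankM_maxr _ _) _; rewrite mxrank_delta.
- by move=> j k jk; rewrite /ip dotN (negbTE jk).
(* [nuc] sums over a chosen list of roots; unique factorisation makes that list a permutation of the
   entries of [sp]. *)
have charM : char_poly (mxH D *m D) = \prod_(l <- [seq sp 0 j | j <- enum 'I_n]) ('X - l%:P).
  rewrite eM char_poly_similar // char_poly_trig ?diag_mx_is_trig // big_map big_enum.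
  by apply: eq_bigr => j _; rewrite mxE eqxx.
rewrite /nuc (perm_big [seq sp 0 j | j <- enum 'I_n]).
  by rewrite big_map big_enum; apply: eq_bigr => j _; rewrite /frob dotN eqxx.
apply: prod_XsubC_eq; rewrite -charM.
have := epsilon_spec (inhabits [::])
  (fun s : seq R[i] => char_poly (mxH D *m D) = \prod_(l <- s) ('X - l%:P)).
by move=> /(_ (ex_intro _ _ charM)).
Qed.

Lemma nuc_ge0 (R : rcfType) (m n : nat) (D : 'M[R[i]]_(m, n)) : 0 <= nuc D.
Proof. by apply: sumr_ge0 => l _; apply: sqrtr_ge0. Qed.

(** Sort the singular terms decreasingly and apply [block_bound]; by orthogonality the leading block
    has norm at most [frob D]. *)
Lemma rip_nuc (R : rcfType) (m n p r s : nat)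
  (A : {linear 'M[R[i]]_(m, n) -> 'cV[R[i]]_p}) (D : 'M[R[i]]_(m, n)) :
  (0 < r <= s)%N -> rip A s (4 / 100) ->
  frob (A D) <= 51 / 50 * (frob D + (Num.sqrt (r%:R : R))^-1 * nuc D).
Proof.
move=> /andP[r0 rs] ripA; have [N [eD rk1 orth eN]] := svd_terms D.
pose ord := sort (fun j k => frob (N k) <= frob (N j)) (index_enum 'I_n).
have tot : total (fun j k => frob (N k) <= frob (N j)) by move=> j k; apply: le_total.
have tr : transitive (fun j k => frob (N k) <= frob (N j)).
  by move=> j k l h1 h2; apply: le_trans h2 h1.
have ps : pairwise (fun j k => frob (N k) <= frob (N j)) ord.
  by rewrite -sorted_pairwise // sort_sorted.
have us : uniq ord by rewrite sort_uniq index_enum_uniq.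
have sumE (V : nmodType) (f : 'I_n -> V) : \sum_(j <- ord) f j = \sum_j f j.
  by apply: perm_big; rewrite perm_sort.
have bdA X : (\rank X <= r)%N -> frob (A X) <= 51 / 50 * frob X.
  by move=> rkX; apply: (rip_frob ripA); apply: leq_trans rs.
have c0 : 0 <= 51 / 50 :> R by lra.
have := block_bound r0 c0 bdA rk1 orth us ps.
rewrite !sumE -eD -eN => h; apply: le_trans h _.
rewrite ler_wpM2l // lerD2r frob_le eD -(sumE _ N).
rewrite !ip_sum_orth // ?take_uniq //.
rewrite -[in leRHS](cat_take_drop r ord) big_cat lerDl.
by apply: sumr_ge0 => j _; apply: ip_ge0.
Qed.

(** * One iteration of ADMiRA and the convergence bound *)

Lemma admira_inv (R : rcfType) (m n p r : nat)
  (A : 'M[R[i]]_(m, n) -> 'cV[R[i]]_p) b (O : set 'M[R[i]]_(m, n)) Xh :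
  admira A b r O Xh ->
  forall k, exists Psih Psip Xt,
    let Y := adj A (b - A (Xh k)) in
    [/\ admissible O r Psih /\ inspan Psih (Xh k),
        admissible O (2 * r) Psip /\
        (forall Psi, admissible O (2 * r) Psi -> frob (proj Psi Y) <= frob (proj Psip Y)),
        inspan (Psip ++ Psih) Xt /\
        (forall X, inspan (Psip ++ Psih) X -> norm2 (b - A Xt) <= norm2 (b - A X)) &
        exists2 Psi, Xh k.+1 = proj Psi Xt &
        forall Phi, admissible O r Phi -> frob (proj Phi Xt) <= frob (proj Psi Xt)].
Proof.
move=> [Psih [Psip [Psit [Xt [X0 [P0 step]]]]]] k.
exists (Psih k), (Psip k.+1), (Xt k.+1) => Y.
have [hPsip ePsit hXt [_ best] eX] := step k.
split; [|exact: hPsip|by rewrite -ePsit|by exists (Psih k.+1)].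
(* The current estimate lies in the span of its support: initially both are trivial, later it is a
   projection made in the preceding iteration. *)
case: k {Y hPsip ePsit hXt best eX} => [|k].
  by rewrite X0 P0; split; [split|apply: inspan0].
by have [_ _ _ [adm _] ->] := step k; split=> //; apply: inspan_proj.
Qed.

(** Constants: [|X - Xt| <= (0.08 |E| + 3.06 |nu|) / 0.96] with [E = X - Xh k]. Truncation doubles
    this to [|E| / 6 + 6.375 |nu|]. *)
Lemma admira_step (R : rcfType) (m n p r : nat)
  (A : {linear 'M[R[i]]_(m, n) -> 'cV[R[i]]_p}) (O : set 'M[R[i]]_(m, n))
  (X : 'M[R[i]]_(m, n)) nu Xh k :
  atoms O -> rip A (4 * r) (4 / 100) -> (\rank X <= r)%N ->
  admira A (A X + nu) r O Xh ->
  frob (X - Xh k.+1) <= 1 / 6 * frob (X - Xh k) + 638 / 100 * frob nu.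
Proof.
move=> hO ripA rkX /admira_inv /(_ k)[Psih [Psip [Xt]]] /=.
move=> [[aPsih hXk] [aPsip bestp] [hXt minXt] [Psi -> bestPsi]].
have rkXk := rank_admissible hO aPsih hXk.
have aPsit : admissible O (3 * r) (Psip ++ Psih).
  case: aPsip aPsih => [pO szp] [hO' szh]; split.
    by move=> a; rewrite mem_cat => /orP[/pO|/hO'].
  by rewrite size_cat mulSn addnC leq_add.
have eb : A X + nu - A (Xh k) = A (X - Xh k) + nu by rewrite linearB /= addrAC.
rewrite eb in bestp; set Y := adj A _ in bestp; pose Y' := proj Psip Y.
have rkY' : (\rank Y' <= 2 * r)%N := rank_admissible hO aPsip (inspan_proj _ _).
have rkE : (\rank (X - Xh k)%R <= 2 * r)%N.
  have := rank_comb 1 (-1) rkX rkXk.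
  by rewrite scale1r scaleN1r mul2n -addnn.
have f1 : frob (X - Xh k - Y') <= 8 / 100 * frob (X - Xh k) + 51 / 25 * frob nu.
  exact: identification ripA rkE rkY' (best_atoms_approx hO bestp rkE).
(* A competitor for the projection of [X] onto the merged span, with error exactly [E - Y']. *)
have hZ : inspan (Psip ++ Psih) (Xh k + Y').
  by apply: inspanD; [apply: inspan_catr|apply/inspan_catl/inspan_proj].
have f2 : 96 / 100 * frob (X - Xt) <= frob (X - proj (Psip ++ Psih) X) + 51 / 50 * frob nu.
  apply: least_squares_error ripA _ _ hXt minXt => Z /(rank_admissible hO aPsit) rkZ.
    by have := rank_comb 1 1 rkX rkZ; rewrite !scale1r -mulSn.
  by rewrite (leq_trans rkZ) // leq_mul2r orbT.
have := proj_min X hZ; rewrite opprD addrA => f3.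
(* As [X] has rank at most [r], truncating [Xt] costs at most [|Xt - X|]. *)
have := best_atoms_approx hO bestPsi rkX; rewrite (frobBC Xt X) => f4.
have := frob_triangle Xt X (proj Psi Xt).
have := frob_ge0 nu; have := frob_ge0 (X - Xh k); name_norms; lra.
Qed.

(** [16 c] is the fixed point of [x -> x / 2 + 8 c]. *)
Lemma half_contraction (R : realFieldType) (u : nat -> R) (c : R) :
  0 <= c -> (forall k, u k.+1 <= 1 / 2 * u k + 8 * c) ->
  forall k, u k <= (1 / 2) ^+ k * u 0%N + 16 * c.
Proof.
move=> c0 step; elim=> [|k IH]; first by rewrite expr0; lra.
by have := step k; rewrite exprS -mulrA; lra.
Qed.

Theorem theorem1 (R : realType) (m n p r : nat)
  (hm : (0 < m)%N) (hn : (0 < n)%N) (hp : (0 < p)%N) (hr : (0 < r)%N)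
  (A : {linear 'M[R[i]]_(m, n) -> 'cV[R[i]]_p})
  (O : set 'M[R[i]]_(m, n)) (hO : atoms O)
  (hA : ric A (4 * r) <= 4 / 100)
  (X0 : 'M[R[i]]_(m, n)) (nu : 'cV[R[i]]_p)
  (X0r : 'M[R[i]]_(m, n)) (hX0r : best_rank_approx r X0 X0r)
  (Xh : nat -> 'M[R[i]]_(m, n))
  (hXh : admira A (A X0 + nu) r O Xh) :
  let eps := frob (X0 - X0r) + (Num.sqrt (r%:R : R))^-1 * nuc (X0 - X0r)
             + norm2 nu in
  (forall k : nat, frob (X0 - Xh k.+1) <= 1 / 2 * frob (X0 - Xh k) + 8 * eps) /\
  (forall k : nat, frob (X0 - Xh k) <= (1 / 2) ^+ k * frob X0 + 16 * eps).
Proof.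
move=> eps; have ripA := ric_rip hA; have [rkX0r _] := hX0r.
(* The part of [X0] beyond rank [r] is treated as additional noise. *)
pose nu' := A (X0 - X0r) + nu.
have eb : A X0 + nu = A X0r + nu' by rewrite /nu' linearB /= addrA addrCA subrr addr0.
have frob_nu' : frob nu' <= 51 / 50 * eps.
  apply: le_trans (frobD _ _) _.
  have : (0 < r <= 4 * r)%N by rewrite hr leq_pmull.
  move=> /(rip_nuc (X0 - X0r)) /(_ ripA).
  by have := frob_ge0 nu; rewrite /eps norm2_frob; name_norms; lra.
have d0 := frob_ge0 (X0 - X0r).
have d_eps : frob (X0 - X0r) <= eps.
  rewrite /eps norm2_frob -addrA lerDl addr_ge0 ?frob_ge0 //.
  by rewrite mulr_ge0 ?nuc_ge0 // invr_ge0 sqrtr_ge0.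
(* Passing from [X0r] to [X0] costs [(1 + 1/6) |X0 - X0r|], and the noise [6.38 * 1.02 eps]: in
   total less than [7.7 eps]. *)
have step k : frob (X0 - Xh k.+1) <= 1 / 2 * frob (X0 - Xh k) + 8 * eps.
  rewrite eb in hXh; have := admira_step k hO ripA rkX0r hXh.
  have := frob_triangle X0r X0 (Xh k.+1); have := frob_triangle X0 X0r (Xh k).
  have := frob_ge0 (X0 - Xh k); rewrite (frobBC X0r X0); name_norms; lra.
have Xh0 : Xh 0%N = 0 by have [? [? [? [? []]]]] := hXh.
split=> // k.
have := @half_contraction _ (fun j => frob (X0 - Xh j)) _ (le_trans d0 d_eps) step k.
by rewrite /= Xh0 subr0.
Qed.
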